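(* Let $\Gamma$ be a reduced graph and $\pi_1,\pi_2\in\mathrm{Aut}^{\pi}(\Gamma)$. Then $$\alpha(\pi_1)=\alpha(\pi_2) \iff \mathrm{Aut}(\Gamma)\pi_1 = \mathrm{Aut}(\Gamma)\pi_2,$$ and consequently $|\mathrm{Im}(\alpha)| = |\mathrm{Aut}^{\pi}(\Gamma)|/|\mathrm{Aut}(\Gamma)|$. Moreover, if $\Gamma$ is connected and nonbipartite, then $|\mathrm{Im}(\alpha)|$ equals the instability index $\mathrm{Inst}(\Gamma)$.
   Context: Graphs are finite, simple, loopless; $N(v)$ is the neighbourhood of $v$; reduced means $N(v)=N(w)\Rightarrow v=w$. $\mathrm{Aut}^{\pi}(\Gamma)$ is the group of bijections $\pi$ of $V$ such that every $\pi(N(v))$ is equal to $N(w)$ for some $w$; $\gamma(\pi)$ is the permutation with $N(\gamma(\pi)(v))=\pi(N(v))$. The map $\alpha:\mathrm{Aut}^{\pi}(\Gamma)\to\mathrm{Aut}^{\pi}(\Gamma)$ is $\alpha(\pi)=\pi^{-1}\circ\gamma(\pi)$. The canonical double cover $\mathrm{B}\Gamma=\Gamma\times K_2$ has vertex set $V\times\{0,1\}$, $(u,i)\sim(v,j)$ iff $(u,v)\in E$ and $i\neq j$; $\mathrm{Inst}(\Gamma)=|\mathrm{Aut}(\mathrm{B}\Gamma)|/(2|\mathrm{Aut}(\Gamma)|)$. *)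

(* Defs.v *)
From mathcomp Require Import all_boot all_order all_algebra all_fingroup.

Set Implicit Arguments.
Unset Strict Implicit.
Unset Printing Implicit Defensive.

Record sgraph := SGraph {
  vertex :> finType;
  adj : rel vertex;
  adj_sym : symmetric adj;
  adj_irr : irreflexive adj
}.

Definition nbhd (G : sgraph) (v : G) : {set G} := [set u | adj v u].

Definition reduced (G : sgraph) : Prop :=
  forall v w : G, nbhd v = nbhd w -> v = w.

Definition connected (G : sgraph) : Prop :=
  0 < #|G| /\ forall u v : G, connect (@adj G) u v.

Definition bipartite (G : sgraph) : Prop :=
  exists c : G -> bool, forall u v : G, adj u v -> c u != c v.

Definition gaut (G : sgraph) : {set {perm G}} :=
  [set s : {perm G} | [forall u, forall v, adj (s u) (s v) == adj u v]].

Definition autpi (G : sgraph) : {set {perm G}} :=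
  [set p : {perm G} | [forall v, exists w, p @: nbhd v == nbhd w]].

Lemma gautP (G : sgraph) (s : {perm G}) :
  reflect (forall u v, adj (s u) (s v) = adj u v) (s \in gaut G).
Proof.
by rewrite inE; apply: (iffP forallP) => [h u v|h u];
  [exact/eqP/(forallP (h u)) | apply/forallP => v; rewrite h].
Qed.

Lemma autpiP (G : sgraph) (p : {perm G}) :
  reflect (forall v, exists w, p @: nbhd v = nbhd w) (p \in autpi G).
Proof.
rewrite inE; apply: (iffP forallP) => h v.
- by have /existsP[w /eqP] := h v; exists w.
- by have [w hw] := h v; apply/existsP; exists w; apply/eqP.
Qed.

Lemma gaut_group_set (G : sgraph) : group_set (gaut G).
Proof.
apply/group_setP; split; first by apply/gautP => u v; rewrite !perm1.
by move=> s t /gautP hs /gautP ht; apply/gautP => u v; rewrite !permM ht.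
Qed.

Canonical gaut_group (G : sgraph) := Group (gaut_group_set G).

Lemma imset_permM (T : finType) (p q : {perm T}) (A : {set T}) :
  (p * q)%g @: A = q @: (p @: A).
Proof. by rewrite -imset_comp; apply: eq_imset => x; rewrite permM. Qed.

Lemma autpi_group_set (G : sgraph) : group_set (autpi G).
Proof.
apply/group_setP; split.
  apply/autpiP => v; exists v; rewrite -[RHS]imset_id.
  by apply: eq_imset => x; rewrite perm1.
move=> p q /autpiP hp /autpiP hq; apply/autpiP => v.
have [w hw] := hp v; have [x hx] := hq w; exists x.
by rewrite imset_permM hw.
Qed.

Canonical autpi_group (G : sgraph) := Group (autpi_group_set G).

(* The default value 1 is never used when G is reduced and p \in autpi G, in
   which case the permutation being picked exists and is unique: see
   nbhd_gamma and gamma_uniq. *)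
Definition gamma (G : sgraph) (p : {perm G}) : {perm G} :=
  odflt 1%g [pick g : {perm G} | [forall v, nbhd (g v) == p @: nbhd v]].

(* The product of permutations acts from left to right, (s * t) x = t (s x),
   so that p^-1 \o gamma p is written gamma p * p^-1. *)
Definition alpha (G : sgraph) (p : {perm G}) : {perm G} :=
  (gamma p * p^-1)%g.

(* For the same reason the set Aut(G)p of all s \o p, s \in Aut(G), is a
   left coset for the product of permutations. *)
Definition aut_coset (G : sgraph) (p : {perm G}) : {set {perm G}} :=
  (p *: gaut G)%g.

Lemma alphaE (G : sgraph) (p : {perm G}) v : alpha p v = (p^-1)%g (gamma p v).
Proof. by rewrite permM. Qed.

Lemma aut_cosetP (G : sgraph) (p q : {perm G}) :
  reflect (exists2 s, s \in gaut G & q =1 s \o p) (q \in aut_coset p).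
Proof.
apply: (iffP lcosetP) => [[s sG ->]|[s sG qE]]; exists s => //.
- by move=> x; rewrite permM.
- by apply/permP => x; rewrite permM qE.
Qed.

Lemma nbhd_gamma (G : sgraph) (p : {perm G}) : reduced G -> p \in autpi G ->
  forall v, nbhd (gamma p v) = p @: nbhd v.
Proof.
move=> Gr /autpiP hp; rewrite /gamma; case: pickP => [g /forallP gP v|no].
  exact/eqP.
have hp' v : exists w, nbhd w == p @: nbhd v.
  by have [w ->] := hp v; exists w.
pose f v := xchoose (hp' v).
have fE v : nbhd (f v) = p @: nbhd v by apply/eqP/(xchooseP (hp' v)).
have f_inj : injective f.
  move=> v w fvw; apply/Gr/(imset_inj (@perm_inj _ p)).
  by rewrite -!fE fvw.
by case/negP: (negbT (no (perm f_inj))); apply/forallP => v; rewrite permE fE.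
Qed.

Lemma gamma_uniq (G : sgraph) (p g : {perm G}) :
    reduced G -> p \in autpi G ->
  (forall v, nbhd (g v) = p @: nbhd v) -> g = gamma p.
Proof.
by move=> Gr pG gP; apply/permP => v; apply: (Gr); rewrite gP nbhd_gamma.
Qed.

Lemma adj_gamma (G : sgraph) (p : {perm G}) : reduced G -> p \in autpi G ->
  forall u v, adj (gamma p v) (p u) = adj v u.
Proof.
move=> Gr pG u v; have := nbhd_gamma Gr pG v => /setP /(_ (p u)).
by rewrite inE mem_imset ?inE //; apply: perm_inj.
Qed.

Lemma gamma_autpi (G : sgraph) (p : {perm G}) :
  reduced G -> p \in autpi G -> gamma p \in autpi G.
Proof.
move=> Gr pG; apply/autpiP => v; exists (p v); apply/setP => x.
rewrite -[x](permKV (gamma p)) mem_imset; last exact: perm_inj.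
by rewrite !inE adj_sym -(adj_gamma Gr pG) adj_sym.
Qed.

Lemma alpha_autpi (G : sgraph) (p : {perm G}) :
  reduced G -> p \in autpi G -> alpha p \in autpi G.
Proof. by move=> Gr pG; rewrite groupM ?groupV ?gamma_autpi. Qed.

Definition dcover_adj (G : sgraph) : rel (G * bool) :=
  fun x y => adj x.1 y.1 && (x.2 != y.2).

Lemma dcover_adj_sym (G : sgraph) : symmetric (@dcover_adj G).
Proof. by move=> x y; rewrite /dcover_adj adj_sym eq_sym. Qed.

Lemma dcover_adj_irr (G : sgraph) : irreflexive (@dcover_adj G).
Proof. by move=> x; rewrite /dcover_adj eqxx andbF. Qed.

Definition dcover (G : sgraph) : sgraph :=
  SGraph (@dcover_adj_sym G) (@dcover_adj_irr G).

Definition inst (G : sgraph) : rat :=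
  (#|gaut (dcover G)|%:R / (2 * #|gaut G|)%:R)%R.

(* Main.v *)
(** If [alpha p1 = alpha p2], then [s = p2 \o p1^-1] is also
    [gamma p2 \o (gamma p1)^-1], and the identity
    [adj (gamma p v) (p u) = adj v u] says that such an [s] is an automorphism;
    conversely [gamma (s \o p)] is [s \o gamma p] for an automorphism [s]. So
    the fibres of [alpha] are the cosets of Aut(G). For G connected and
    nonbipartite, an automorphism of the double cover acts as [p] on one layer
    and as [gamma p] on the other, and it either preserves or exchanges the
    layers; hence there are [2 * #|autpi G|] of them. *)

Require Import Defs.
From mathcomp Require Import all_boot all_order all_algebra all_fingroup.

Import GRing.Theory Num.Theory.

Set Implicit Arguments.
Unset Strict Implicit.
Unset Printing Implicit Defensive.

(** Both images count the classes of [A] under the common kernel; each inequality comes from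
    factoring one function through the other. *)
Lemma card_imset_same_kernel (T U W : finType) (f : T -> U) (g : T -> W)
    (A : {set T}) :
    (forall x y, x \in A -> y \in A -> (f x = f y <-> g x = g y)) ->
  #|f @: A| = #|g @: A|.
Proof.
have le (U' W' : finType) (f' : T -> U') (g' : T -> W') :
    (forall x y, x \in A -> y \in A -> f' x = f' y -> g' x = g' y) ->
    #|g' @: A| <= #|f' @: A|.
  (* [h] factors [g'] through [f'] on [A]; it is [None] outside the image of [f']. *)
  move=> fg; pose h u := omap g' [pick x in A | f' x == u].
  have hE x : x \in A -> h (f' x) = Some (g' x).
    move=> xA; rewrite /h; case: pickP => [y /andP[yA /eqP e]|/(_ x)] /=.
      by rewrite (fg _ _ yA xA e).
    by rewrite xA eqxx.
  rewrite -(card_imset _ Some_inj).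
  apply: leq_trans (leq_imset_card h _); apply/subset_leq_card/subsetP => z.
  case/imsetP=> w /imsetP[x xA ->] ->.
  by rewrite -hE //; apply/imset_f/imset_f.
move=> fg; apply/eqP; rewrite eqn_leq !le // => x y xA yA; last by apply fg.
by move=> e; apply/fg.
Qed.

Lemma gaut_sub_autpi (G : sgraph) : gaut G \subset autpi G.
Proof.
apply/subsetP => s /gautP sG; apply/autpiP => v; exists (s v).
apply/setP => x; rewrite -[x](permKV s) mem_imset; last exact: perm_inj.
by rewrite !inE sG.
Qed.

(** The automorphism [s] carries the neighbourhood of [gamma p v] to that of [s (gamma p v)], so
    uniqueness of [gamma] applies. *)
Lemma gamma_mul_gaut (G : sgraph) (p s : {perm G}) :
    reduced G -> p \in autpi G -> s \in gaut G ->
  gamma (p * s)%g = (gamma p * s)%g.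
Proof.
move=> Gr pG sG; have sG' := subsetP (gaut_sub_autpi G) s sG.
apply/esym/gamma_uniq => // [|v]; first exact: groupM.
rewrite imset_permM -(nbhd_gamma Gr pG) permM; apply/setP => x.
rewrite -[x](permKV s) mem_imset; last exact: perm_inj.
by move/gautP: sG => sG; rewrite !inE sG.
Qed.

Lemma alpha_eqP (G : sgraph) (p1 p2 : {perm G}) :
    reduced G -> p1 \in autpi G -> p2 \in autpi G ->
  (alpha p1 = alpha p2 <-> aut_coset p1 = aut_coset p2).
Proof.
move=> Gr p1G p2G; split=> [e|/lcoset_eqP].
  apply/lcoset_eqP; rewrite -lcoset_sym mem_lcoset.
  have e' : (p1^-1 * p2 = (gamma p1)^-1 * gamma p2)%g.
    move: e; rewrite /alpha => e.
    by rewrite -[gamma p2](mulgKV p2) -e !mulgA mulVg mul1g.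
  apply/gautP => u v.
  (* Only the first endpoint takes the [gamma] form: [adj_gamma] for [p2] strips the outer maps, and
     [adj_gamma] for [p1] then restores [u] and [v]. *)
  rewrite [X in adj X](_ : _ = gamma p2 ((gamma p1)^-1%g u)); last first.
    by rewrite e' permM.
  rewrite permM adj_gamma // -(adj_gamma Gr p1G).
  by rewrite !permKV.
case/lcosetP=> s sG ->; rewrite /alpha gamma_mul_gaut //.
by rewrite invMg mulgA mulgK.
Qed.

(** By Lagrange it suffices to count cosets, and [alpha] has the same kernel as the map to
    cosets. *)
Lemma card_im_alpha (G : sgraph) : reduced G ->
  (#|@alpha G @: autpi G| * #|gaut G|)%N = #|autpi G|.
Proof.
move=> Gr; rewrite -(Lagrange (gaut_sub_autpi G)) -card_lcosets mulnC.
congr (_ * _)%N; apply: card_imset_same_kernel => x y xG yG.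
by rewrite !lcosetE; exact: alpha_eqP.
Qed.

(** The bit [q.2] is the layer that receives layer [false]. *)
Definition layer_map (G : sgraph) (q : {perm G} * bool) (x : dcover G) :
    dcover G :=
  if x.2 then (gamma q.1 x.1, ~~ q.2) else (q.1 x.1, q.2).

Lemma layer_map_inj (G : sgraph) (q : {perm G} * bool) :
  injective (layer_map q).
Proof.
case: q => p b [u []] [v []]; rewrite /layer_map /=.
all: by case: b => -[] // /perm_inj ->.
Qed.

Definition layer_perm (G : sgraph) (q : {perm G} * bool) : {perm dcover G} :=
  perm (@layer_map_inj G q).

(** The action on layer [false] determines the pair; reading off the bit takes a vertex. *)
Lemma layer_perm_inj (G : sgraph) : 0 < #|G| -> injective (@layer_perm G).
Proof.
case/card_gt0P=> v0 _ [p b] [q c] e.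
have E v : (p v, b) = (q v, c).
  by have /permP/(_ (v, false)) := e; rewrite !permE.
have [_ ->] := E v0; congr pair; apply/permP => v.
by have [->] := E v.
Qed.

Lemma layer_perm_gaut (G : sgraph) (p : {perm G}) (b : bool) :
  reduced G -> p \in autpi G -> layer_perm (p, b) \in gaut (dcover G).
Proof.
move=> Gr pG; apply/gautP => -[u i] [v j].
rewrite !permE /layer_map /= /dcover_adj /=.
case: i; case: j => /=; rewrite ?eqxx ?andbF //.
  by rewrite adj_gamma //; case: b.
by rewrite adj_sym adj_gamma // adj_sym; case: b.
Qed.

Lemma connected_constant (G : sgraph) (T : Type) (f : G -> T) :
    connected G -> (forall u v, adj u v -> f u = f v) ->
  forall u v, f u = f v.
Proof.
move=> [_ Gc] fP u v; have /connectP[s + ->] := Gc u v.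
by elim: s u => //= w s IH u /andP[/fP -> /IH].
Qed.

Lemma dcover_aut_layers (G : sgraph) (s : {perm dcover G}) :
    connected G -> ~ bipartite G -> s \in gaut (dcover G) ->
  exists b, forall x : dcover G, (s x).2 = x.2 (+) b.
Proof.
move=> Gc Gnb /gautP sG.
(* [f v i] tells whether [s] moves [(v, i)] to the other layer. It is constant along edges of the
   cover, and the goal is that it is constant. *)
pose f v i := (s (v, i)).2 (+) i.
have fP u v i : adj u v -> f u i = f v (~~ i).
  move=> uv; have := sG (u, i) (v, ~~ i).
  rewrite /= /dcover_adj /= uv.
  rewrite /f; case: (s _) => a1 a2; case: (s _) => b1 b2 /=.
  by case: i; case: a2; case: b2; rewrite ?andbF.
(* [e v] says that the two vertices over [v] are mapped to different layers; it
   is invariant along edges, and if it is false everywhere then [f^~ false] is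
   a 2-colouring. *)
pose e v := f v false == f v true.
have eC : forall u v, e u = e v.
  apply: connected_constant => // u v uv.
  by rewrite /e (fP u v) // (fP u v true) //= eq_sym.
have [/card_gt0P[v0 _] _] := Gc.
case e0: (e v0); last first.
  case: Gnb; exists (f^~ false) => u v uv.
  by rewrite (fP u v) // eq_sym -[_ == _]/(e v) (eC v v0) e0.
have ev v : f v true = f v false.
  by apply/esym/eqP; rewrite -[_ == _]/(e v) (eC v v0).
have fC : forall u v, f u false = f v false.
  by apply: connected_constant => // u v uv; rewrite (fP u v) // ev.
exists (f v0 false) => -[v i]; rewrite (fC v0 v).
have -> : f v false = f v i by case: i.
by rewrite /f /= addbC addbK.
Qed.

(** The actions [p] and [g] of [s] on the two layers satisfy [nbhd (g v) = p @: nbhd v], since [s]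
    preserves the edges between layers; hence [g] is [gamma p]. *)
Lemma dcover_aut_layer_perm (G : sgraph) (s : {perm dcover G}) :
    reduced G -> connected G -> ~ bipartite G -> s \in gaut (dcover G) ->
  exists2 q, q.1 \in autpi G & s = layer_perm q.
Proof.
move=> Gr Gc Gnb sG; have [b bE] := dcover_aut_layers Gc Gnb sG.
pose f i v := (s (v, i)).1.
have sE v i : s (v, i) = (f i v, i (+) b).
  by rewrite [LHS]surjective_pairing bE.
have f_inj i : injective (f i).
  move=> u v uv; have : s (u, i) = s (v, i) by rewrite !sE uv.
  by case/perm_inj.
pose p := perm (@f_inj false); pose g := perm (@f_inj true).
have adj_g u v : adj (g v) (p u) = adj v u.
  have /gautP/(_ (v, true) (u, false)) := sG.
  by rewrite !sE /= /dcover_adj /= !permE; case: (b); rewrite !andbT.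
have gE v : nbhd (g v) = p @: nbhd v.
  apply/setP => x; rewrite -[x](permKV p) mem_imset; last exact: perm_inj.
  by rewrite !inE adj_g.
have pG : p \in autpi G by apply/autpiP => v; exists (g v).
exists (p, b) => //; apply/permP => -[v i].
rewrite sE !permE /layer_map /= -(gamma_uniq Gr pG gE).
by case: i; rewrite permE.
Qed.

Lemma card_dcover_gaut (G : sgraph) :
    reduced G -> connected G -> ~ bipartite G ->
  #|gaut (dcover G)| = (2 * #|autpi G|)%N.
Proof.
move=> Gr Gc Gnb; have [G_gt0 _] := Gc.
have -> : gaut (dcover G) = @layer_perm G @: setX (autpi G) [set: bool].
  apply/setP => s; apply/idP/imsetP => [sG|[[p b]]].
    have [q qG ->] := dcover_aut_layer_perm Gr Gc Gnb sG.
    by exists q; rewrite // inE qG inE.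
  by rewrite inE => /andP[pG _] ->; exact: layer_perm_gaut.
rewrite card_imset; last exact: layer_perm_inj.
by rewrite cardsX cardsT card_bool mulnC.
Qed.

Theorem theorem2p5 (G : sgraph) (G_reduced : reduced G) :
  (forall p1 p2 : {perm G}, p1 \in autpi G -> p2 \in autpi G ->
     (alpha p1 = alpha p2 <-> aut_coset p1 = aut_coset p2))
  /\ (#|@alpha G @: autpi G|%:R = #|autpi G|%:R / #|gaut G|%:R :> rat)%R
  /\ (connected G -> ~ bipartite G ->
      (#|@alpha G @: autpi G|%:R = inst G)%R).
Proof.
have gaut_neq0 : (#|gaut G|%:R != 0 :> rat)%R.
  by rewrite pnatr_eq0 -lt0n cardG_gt0.
have cardE :
    (#|@alpha G @: autpi G|%:R = #|autpi G|%:R / #|gaut G|%:R :> rat)%R.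
  by rewrite -(card_im_alpha G_reduced) natrM mulfK.
split; first by move=> p1 p2; exact: alpha_eqP.
(* The factor 2 from exchanging the layers cancels the 2 in the denominator of [inst]. *)
split=> // Gc Gnb; rewrite cardE /inst card_dcover_gaut // !natrM.
by rewrite -mulf_div divff ?mul1r ?pnatr_eq0.
Qed.
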